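(* Let $\lambda$ be a nonzero real number, let $(a_{n,\lambda})_{n\ge 0}$ be a sequence of real numbers, and let $(a_{n,k}(\lambda))_{n,k\ge 0}$ be its degenerate Euler-Seidel matrix. Let $S_{\lambda}(t)=\sum_{n=0}^{\infty}a_{n,0}(\lambda)\frac{t^{n}}{n!}$ be the exponential generating function of the initial degenerate sequence $(a_{n,0}(\lambda))_{n\ge 0}$. Then the exponential generating function of the final degenerate sequence $(a_{0,n}(\lambda))_{n\ge 0}$ is given by $$\overline{S_{\lambda}}(t)=\sum_{n=0}^{\infty}a_{0,n}(\lambda)\frac{t^{n}}{n!}=e_{\lambda}^{1-\lambda}(t)\,S_{\lambda}(t),$$ as an identity of formal power series in $t$.
   Context: For a nonzero real number $\lambda$ and real $x$, the generalized falling factorials are $(x)_{0,\lambda}=1$ and $(x)_{n,\lambda}=x(x-\lambda)\cdots(x-(n-1)\lambda)$ for $n\ge 1$, and the degenerate exponential is the power series $e_{\lambda}^{x}(t)=\sum_{k=0}^{\infty}(x)_{k,\lambda}\frac{t^{k}}{k!}$. Given a sequence $(a_{n,\lambda})_{n\ge 0}$, its degenerate Euler-Seidel matrix $(a_{n,k}(\lambda))_{n,k\ge 0}$ is defined recursively by $a_{n,0}(\lambda)=a_{n,\lambda}$ for $n\ge 0$, and $a_{n,k}(\lambda)=\big(1-(k-n)\lambda\big)a_{n,k-1}(\lambda)+a_{n+1,k-1}(\lambda)$ for $n\ge 0$, $k\ge 1$. *)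

(* Defs.v *)
From mathcomp Require Import all_boot all_order all_algebra.
From mathcomp Require Import reals.

Set Implicit Arguments.
Unset Strict Implicit.
Unset Printing Implicit Defensive.

Import GRing.Theory.
Local Open Scope ring_scope.

(* A formal power series over R is its sequence of coefficients: f n is the
   coefficient of t ^ n.  Equality of series is equality of these functions. *)
Definition fps (R : realType) : Type := nat -> R.

(* The Cauchy product. *)
Definition fps_mul (R : realType) (f g : fps R) : fps R :=
  fun n => \sum_(i < n.+1) f i * g (n - i)%N.

(* \sum_n u n * t ^ n / n! *)
Definition egf (R : realType) (u : nat -> R) : fps R :=
  fun n => u n / n`!%:R.

(* (x)_{n,lam} = x (x - lam) ... (x - (n - 1) lam) *)
Definition dffact (R : realType) (lam x : R) (n : nat) : R :=
  \prod_(i < n) (x - i%:R * lam).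

(* e_lam^x(t), as a series in t *)
Definition dexp (R : realType) (lam x : R) : fps R :=
  egf (dffact lam x).

(* desm lam a n k is the entry a_{n,k}(lam).  The difference k - n is taken
   in R, hence may be negative. *)
Fixpoint desm (R : realType) (lam : R) (a : nat -> R) (n k : nat) {struct k} : R :=
  match k with
  | 0 => a n
  | k'.+1 =>
      (1 - (k'.+1%:R - n%:R) * lam) * desm lam a n k' + desm lam a n.+1 k'
  end.

(* Main.v *)
Require Import Defs.
From mathcomp Require Import all_boot all_order all_algebra.
From mathcomp Require Import reals.
From mathcomp Require Import boolp ring.

Import GRing.Theory.
Local Open Scope ring_scope.

(** The whole matrix has a closed form: writing [x = 1 - lam + n * lam],

      [a_{n,k} = \sum_(i <= k) 'C(k, i) * (x)_{k-i,lam} * a_{n+i}].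

    This is proved by induction on [k] ([desmE]).  Passing from row [n] to row
    [n + 1] replaces [x] by [x + lam], and [(x + lam)_{m+1} = (x + lam) * (x)_m],
    so the recurrence reduces, coefficient by coefficient, to a degenerate
    version of Pascal's rule ([dffact_pascal]), itself a consequence of
    [(j + 1) * 'C(k, j + 1) = (k - j) * 'C(k, j)].  For [n = 0] one has
    [x = 1 - lam], and the closed form is the binomial convolution of
    [(1 - lam)_{.,lam}] and [a], that is, the product of their exponential
    generating functions. *)

Lemma dffact0 (R : realType) (lam x : R) : dffact lam x 0 = 1.
Proof. by rewrite /dffact big_ord0. Qed.

Lemma dffactS (R : realType) (lam x : R) (m : nat) :
  dffact lam x m.+1 = dffact lam x m * (x - m%:R * lam).
Proof. by rewrite /dffact big_ord_recr. Qed.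

Lemma dffact_shift (R : realType) (lam x : R) (m : nat) :
  dffact lam (x + lam) m.+1 = (x + lam) * dffact lam x m.
Proof.
rewrite /dffact big_ord_recl /= mul0r subr0; congr (_ * _).
apply: eq_bigr => i _; rewrite /= /bump /= natrD.
by ring.
Qed.

(** For [j = k] the first term vanishes because ['C(k, k + 1) = 0], whatever the
    value of the truncated index [k - (k + 1)]. *)
Lemma dffact_pascal (R : realType) (lam x : R) (k j : nat) : (j <= k)%N ->
  (x - k%:R * lam) * ('C(k, j.+1)%:R * dffact lam x (k - j.+1)) +
    'C(k, j)%:R * dffact lam (x + lam) (k - j) =
  'C(k.+1, j.+1)%:R * dffact lam x (k - j).
Proof.
rewrite leq_eqVlt => /orP[/eqP->|ltjk].
  by rewrite bin_small // subnn !dffact0 !binn; ring.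
have ek : (k - j = (k - j.+1).+1)%N by rewrite subnSK.
have eC : (k - j)%:R * 'C(k, j)%:R = j.+1%:R * 'C(k, j.+1)%:R :> R.
  by rewrite -!natrM -mul_bin_left mulnC.
have kE : k%:R = (k - j.+1)%:R + j.+1%:R :> R by rewrite -natrD subnK.
move: eC; rewrite ek dffact_shift dffactS binS natrD kE.
move: (k - j.+1)%N => m; rewrite -(@natr1 _ m) => eC.
(* The difference of the two sides is [lam * (x)_m] times that of the sides of [eC]. *)
apply/eqP; rewrite -subr_eq0; apply/eqP.
transitivity (lam * dffact lam x m *
  ((m%:R + 1) * 'C(k, j)%:R - j.+1%:R * 'C(k, j.+1)%:R)); first by ring.
by rewrite eC subrr mulr0.
Qed.

Lemma desmE (R : realType) (lam : R) (a : nat -> R) (n k : nat) :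
  desm lam a n k =
  \sum_(i < k.+1)
    'C(k, i)%:R * dffact lam (1 - lam + n%:R * lam) (k - i) * a (n + i)%N.
Proof.
elim: k n => [|k IHk] n.
  by rewrite big_ord1 /= dffact0 bin0 addn0 !mul1r.
rewrite /= !IHk; set x := 1 - lam + n%:R * lam.
have -> : 1 - (k.+1%:R - n%:R) * lam = x - k%:R * lam.
  by rewrite /x -natr1; ring.
have -> : 1 - lam + n.+1%:R * lam = x + lam by rewrite /x -natr1; ring.
(* The first sum is extended by the zero term [i = k + 1], so that, its term
   [i = 0] set apart, it runs over the same indices as the second one. *)
have -> : \sum_(i < k.+1) 'C(k, i)%:R * dffact lam x (k - i) * a (n + i)%N =
          \sum_(i < k.+2) 'C(k, i)%:R * dffact lam x (k - i) * a (n + i)%N.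
  by rewrite [RHS]big_ord_recr /= [X in X%:R]bin_small // !mul0r addr0.
rewrite big_ord_recl [RHS]big_ord_recl /= mulrDr -addrA; congr (_ + _).
  by rewrite !bin0 !subn0 dffactS; ring.
rewrite mulr_sumr -big_split /=; apply: eq_bigr => j _.
rewrite /bump /= !add1n subSS addSnnS -dffact_pascal ?leq_ord //.
by ring.
Qed.

Lemma fps_mul_egf (R : realType) (u v : nat -> R) :
  fps_mul (egf u) (egf v) =
  egf (fun n => \sum_(i < n.+1) 'C(n, i)%:R * u (n - i)%N * v i).
Proof.
apply/funext => n; rewrite /fps_mul /egf mulr_suml.
rewrite (reindex_inj rev_ord_inj) /=; apply: eq_bigr => i _.
have lein : (i <= n)%N by rewrite leq_ord.
have factN0 m : m`!%:R != 0 :> R by rewrite Num.Theory.pnatr_eq0 -lt0n fact_gt0.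
rewrite subSS subKn // -(bin_fact lein) !natrM.
field.
by rewrite !factN0 Num.Theory.pnatr_eq0 -lt0n bin_gt0 lein.
Qed.

Theorem theorem2p4 (R : realType) (lam : R) (hlam : lam != 0) (a : nat -> R) :
  egf (fun n => desm lam a 0%N n) =
  fps_mul (dexp lam (1 - lam)) (egf (fun n => desm lam a n 0%N)).
Proof.
rewrite /dexp fps_mul_egf; congr egf; apply/funext => n.
rewrite desmE mul0r addr0.
by apply: eq_bigr => i _; rewrite add0n.
Qed.
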